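(* Let $E$ be a finite linearly ordered set of cardinality $n$. The map $\Psi$ which sends a bijection $\sigma\in \mathbb{S}_E$ to the monomial $\prod_{i\in \mathrm{Des}(\sigma)} h_{S(\sigma,i)}$ is a bijection between $\mathbb{S}_E$ and $\mathrm{NM}(E)$.
   Context: For a finite linearly ordered set $E$ of cardinality $n$, write $[n]=\{1,\dots,n\}$ and let $\mathbb{S}_E$ be the set of bijections $\sigma:[n]\to E$. An element $i\in[n-1]$ is a descent of $\sigma$ if $\sigma(i)>\sigma(i+1)$; $\mathrm{Des}(\sigma)$ is the set of descents of $\sigma$. For $i\in\mathrm{Des}(\sigma)$ put $S(\sigma,i)=\{\sigma(j)\mid j\ge i,\ \sigma(j)\le\sigma(i)\}\subset E$. For nonempty subsets $I\subset J$ of $E$, $I$ is an initial segment of $J$ if $I=J\cap\{i\in E\mid i\le \max I\}$. Consider commuting variables $h_S$ indexed by the subsets $S\subset E$ with at least $2$ elements. A quadratic monomial in these variables is called normal if it can be written as $h_{S_1}h_{S_2}$ where, setting $S=S_1\cup S_2$: (i) $\mathrm{Card}(S_1)\ge2$ and $\mathrm{Card}(S_2)\ge 2$; (ii) $S_1$ is an initial segment of $S$, and it is the minimal initial segment $I$ of $S$ satisfying $I\cup S_2=S$; (iii) $\mathrm{Card}(S\setminus S_2)\ge2$ unless $S_2=S\setminus\{\max S\}$. A monomial (of any degree, including $1$) in the variables $h_S$ is called normal if all its quadratic submonomials (divisors of degree $2$) are normal. $\mathrm{NM}(E)$ denotes the set of normal monomials. (These are the normal monomials of a known quadratic Gröbner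 basis of the Chow ring of the boolean matroid on $E$ in its simplicial presentation.) *)

(* Defs.v *)
From HB Require Import structures.
From mathcomp Require Import all_boot all_order.
From mathcomp Require Import finmap.
From mathcomp Require Import classical_sets functions.
From mathcomp Require Import finset monalg.

Set Implicit Arguments.
Unset Strict Implicit.
Unset Printing Implicit Defensive.

Import Order.TTheory.

Local Open Scope nat_scope.
Local Open Scope order_scope.

Section Definitions.

Context {d : Order.disp_t} {E : finOrderType d}.

(* The maximum as a relation: [is_max A x] never holds for empty [A]. *)
Definition is_max (A : {set E}) (x : E) : bool :=
  (x \in A) && [forall y in A, y <= x].

Definition initial_segment (I J : {set E}) : bool :=
  [&& I != set0, I \subset J &
      [exists x, is_max I x && (I == J :&: [set y | y <= x])]].

Definition normal_pair (S1 S2 : {set E}) : bool :=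
  let S := S1 :|: S2 in
  [&& (2 <= #|S1|)%N && (2 <= #|S2|)%N,
      initial_segment S1 S &&
        minset [pred I | initial_segment I S & I :|: S2 == S] S1 &
      (2 <= #|S :\: S2|)%N || [exists x, is_max S x && (S2 == S :\ x)]].

(* The index set of the variables h_S, and the monomials in them. *)
Definition big_subset := {S : {set E} | (2 <= #|S|)%N}.

Definition monomial := {cmonom big_subset}.

Definition h (S : big_subset) : monomial := ucm S.

Definition normal_quadratic (q : monomial) : Prop :=
  exists S1 S2 : big_subset, q = mmul (h S1) (h S2) /\
    normal_pair (val S1) (val S2).

Definition monomial_divides (q m : monomial) : Prop :=
  exists r : monomial, m = mmul q r.

Definition normal_monomial (m : monomial) : Prop :=
  forall q : monomial,
    mdeg q = 2%N -> monomial_divides q m -> normal_quadratic q.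

(* [n] = {1, ..., n} is encoded as 'I_n, positions being numbered from 0. *)
Section Bijections.

Context {n : nat}.
Implicit Types (s : {ffun 'I_n -> E}) (i j : 'I_n).

Definition descents s : {set 'I_n} :=
  [set i : 'I_n | [exists j : 'I_n, (j == i.+1 :> nat) && (s j < s i)]].

Definition descent_set s i : {set E} :=
  [set s j | j : 'I_n & (i <= j)%N && (s j <= s i)].

(* s(i) and s(i+1) are two distinct elements of S(s, i). *)
Lemma card_descent_set s i : i \in descents s -> (2 <= #|descent_set s i|)%N.
Proof.
rewrite inE => /existsP[j /andP[/eqP ji sji]].
have <- : #|[set s i; s j]| = 2%N by rewrite cards2 (gt_eqF sji).
apply/subset_leq_card/fintype.subsetP => x; rewrite !inE => /orP[] /eqP ->.
  by apply/imsetP; exists i; rewrite // inE leqnn lexx.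
by apply/imsetP; exists j; rewrite // inE ji leqnSn ltW.
Qed.

Definition descent_var s (i : {i | i \in descents s}) : big_subset :=
  Sub (descent_set s (val i)) (card_descent_set (valP i)).

Definition Psi s : monomial :=
  \big[mmul/mone]_(i : {i | i \in descents s}) h (descent_var i).

End Bijections.

End Definitions.

Arguments big_subset {d} E.
Arguments monomial {d} E.

Local Open Scope classical_set_scope.

Definition bijections {d : Order.disp_t} (E : finOrderType d) (n : nat) :
  set {ffun 'I_n -> E} := [set s : {ffun 'I_n -> E} | bijective s].

Arguments bijections {d} E n.

Definition NM {d : Order.disp_t} (E : finOrderType d) : set (monomial E) :=
  [set m | normal_monomial m].

Arguments NM {d} E.

(* Main.v *)
(* A bijection is a word in which every letter of E occurs once.  Listing its
   descent sets from left to right gives sets S_1, S_2, ... such that (S_i, S_j)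
   is a normal pair for all i < j.  Conversely, "being a normal pair" is
   asymmetric and has no 3-cycles, so the sets occurring in a normal monomial
   carry exactly one linear order S_1, S_2, ... of this kind, and the word is
   recovered letter by letter: if S_1 is an initial segment of the alphabet then
   the first letter is max S_1 and is a descent; otherwise it is the least letter
   outside S_1 and is not one.  Deleting this letter (and S_1, in the first case)
   leaves a problem of the same kind on a smaller alphabet. *)

Require Import Defs.
From mathcomp Require Import all_boot all_order.
From mathcomp Require Import classical_sets functions.
From mathcomp Require Import finmap monalg fintype finset.

Set Implicit Arguments.
Unset Strict Implicit.
Unset Printing Implicit Defensive.

Import Order.TTheory.

Local Open Scope nat_scope.
Local Open Scope order_scope.

(** * Normal pairs and the linear order on a normal family *)

Section NormalPairs.

Context {d : Order.disp_t} {E : finOrderType d}.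
Implicit Types (A S I : {set E}) (x y : E).

Definition is_min A x := (x \in A) && [forall y in A, x <= y].

Lemma is_maxP A x :
  reflect (x \in A /\ {in A, forall y, y <= x}) (is_max A x).
Proof. by apply: (iffP andP) => -[xA /forall_inP maxx]. Qed.

Lemma is_minP A x :
  reflect (x \in A /\ {in A, forall y, x <= y}) (is_min A x).
Proof. by apply: (iffP andP) => -[xA /forall_inP minx]. Qed.

Lemma max_exists A : A != set0 -> exists x, is_max A x.
Proof.
case/set0Pn => a aA; case: (@arg_maxP _ _ E a (mem A) id aA) => x xA maxx.
by exists x; apply/is_maxP.
Qed.

Lemma min_exists A : A != set0 -> exists x, is_min A x.
Proof.
case/set0Pn => a aA; case: (@arg_minP _ _ E a (mem A) id aA) => x xA minx.
by exists x; apply/is_minP.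
Qed.

Lemma max_unique A x y : is_max A x -> is_max A y -> x = y.
Proof.
move=> /is_maxP[xA maxx] /is_maxP[yA maxy].
by apply/le_anti; rewrite maxy ?maxx.
Qed.

Lemma min_unique A x y : is_min A x -> is_min A y -> x = y.
Proof.
move=> /is_minP[xA minx] /is_minP[yA miny].
by apply/le_anti; rewrite minx ?miny.
Qed.

Lemma initial_segmentP I A x : is_max I x ->
  reflect (I = A :&: [set y | y <= x]) (initial_segment I A).
Proof.
move=> maxI; have /is_maxP[xI _] := maxI; apply: (iffP and3P).
  by case=> _ _ /existsP[z /andP[maxz /eqP {1}->]]; rewrite (max_unique maxI maxz).
move=> defI; split; first by apply/set0Pn; exists x.
  by rewrite defI subsetIl.
by apply/existsP; exists x; rewrite maxI -defI eqxx.
Qed.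

(** If [x] were in [S2], then [S1 :\ x] would be a smaller initial segment still covering the union;
    so minimality in (ii) amounts to [x \notin S2]. Given this, [x] already counts once in (iii),
    and the exceptional case there can only remove [x]. *)
Lemma normal_pairP S1 S2 x : is_max S1 x ->
  reflect [/\ (2 <= #|S1|)%N, (2 <= #|S2|)%N, x \notin S2,
              {in S2, forall y, y <= x -> y \in S1} &
              S2 = S1 :\ x \/ exists2 y, y \in S1 :\ x & y \notin S2]
    (normal_pair S1 S2).
Proof.
move=> maxS1; have /is_maxP[xS1 lex] := maxS1.
apply: (iffP and3P) => [[/andP[c1 c2] /andP[inS1 minS1] dS2]|[c1 c2 xNS2 S2x dS2]].
  have defS1 := initial_segmentP _ maxS1 inS1.
  have S2x : {in S2, forall y, y <= x -> y \in S1}.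
    by move=> y yS2 yx; rewrite defS1 !inE yS2 orbT.
  have xNS2 : x \notin S2.
    apply/negP => xS2.
    have/max_exists[z maxz]: S1 :\ x != set0.
      by rewrite -card_gt0; move: c1; rewrite (cardsD1 x) xS1.
    have /is_maxP[zS1 lez] := maxz.
    have [zx {}zS1] := setD1P zS1.
    case/minsetP: minS1 => _ /(_ (S1 :\ x)) minS1.
    suff: S1 :\ x = S1 by move/setP/(_ x); rewrite !inE xS1 eqxx.
    apply: minS1; last exact: subsetDl.
    apply/andP; split.
      apply/(initial_segmentP _ maxz)/setP => y; rewrite in_setI [X in _ && X]inE.
      apply/idP/andP => [yS|[yS yz]].
        by split; last exact: lez; move/setD1P: yS => [_ yS]; rewrite inE yS.
      have yx : y <= x by apply: le_trans yz (lex _ zS1).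
      apply/setD1P; split; last by rewrite {1}defS1 inE yS inE.
      by apply: contraNneq zx => yx'; rewrite eq_le lex // -yx'.
    rewrite /= eqEsubset; apply/andP; split.
      by apply: setSU; apply: subsetDl.
    apply/subsetP => y.
    by rewrite !inE; case: eqVneq => [->|] //=.
  split=> //; case/orP: dS2 =>
    [/card_gt1P[y [z [yS zS yz]]]|/existsP[z /andP[maxz /eqP eS2]]].
    have sub w : w \in (S1 :|: S2) :\: S2 -> w \in S1 /\ w \notin S2.
      by rewrite !inE; case: (w \in S2) => //=; rewrite orbF.
    right; have [yx|yx] := eqVneq y x.
      exists z; last by case: (sub _ zS).
      by rewrite !inE -yx eq_sym yz; case: (sub _ zS).
    by exists y; [rewrite !inE yx|]; case: (sub _ yS).
  (* [x] is in the union but not in [S2], so it is the one element that [S2] omits. *)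
  have zx : x = z.
    move/setP/(_ x): eS2; rewrite (negbTE xNS2) !inE xS1 andbT.
    by move/esym/negbFE/eqP.
  left; rewrite {1}eS2 -zx; apply/setP => y; rewrite !inE.
  case: eqVneq => //= _; case yS2: (y \in S2); last by rewrite orbF.
  by rewrite orbT (S2x _ yS2) // zx; case/is_maxP: maxz => _; apply; rewrite inE yS2 orbT.
have inS1 : initial_segment S1 (S1 :|: S2).
  apply/(initial_segmentP _ maxS1)/setP => y; rewrite !inE.
  apply/idP/andP => [yS|[/orP[]// yS2 yx]]; first by rewrite yS lex.
  exact: S2x.
split; first by rewrite c1.
  rewrite inS1 /=; apply/minsetP; split=> [|I]; first by rewrite /= inS1 eqxx.
  move=> /andP[inI /eqP IU] IS1; apply/eqP; rewrite eqEsubset IS1 /=.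
  (* Since [S2] misses [x], a covering [I] must contain it, and with it everything of [S1] below. *)
  have xI : x \in I.
    by move/setP/(_ x): IU; rewrite !inE (negbTE xNS2) xS1 orbF.
  have I0 : I != set0 by apply/set0Pn; exists x.
  have [z maxz] := max_exists I0.
  have /is_maxP[zI lez] := maxz.
  rewrite (initial_segmentP _ maxz inI); apply/subsetP => y yS1.
  by rewrite !inE yS1 /=; apply: le_trans (lex _ yS1) (lez _ xI).
apply/orP; case: dS2 => [defS2|[y /setD1P[yx yS1] yS2]].
  right; apply/existsP; exists x.
  have -> : S1 :|: S2 = S1 by apply/setUidPl; rewrite defS2 subsetDl.
  by rewrite maxS1 defS2 eqxx.
left; apply/card_gt1P; exists x, y.
by rewrite !inE xNS2 yS2 xS1 yS1 eq_sym.
Qed.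

Lemma normal_pair_max S1 S2 : normal_pair S1 S2 -> exists x, is_max S1 x.
Proof.
by case/and3P => /andP[c1 _] _ _; apply: max_exists; rewrite -card_gt0 ltnW.
Qed.

(* The smaller of the two maxima would have to lie in both sets. *)
Lemma normal_pair_asym S1 S2 : normal_pair S1 S2 -> ~~ normal_pair S2 S1.
Proof.
move=> n12; apply/negP => n21.
have [x maxx] := normal_pair_max n12; have [y maxy] := normal_pair_max n21.
have [_ _ xS2 S2x _] := normal_pairP _ maxx n12.
have [_ _ yS1 S1y _] := normal_pairP _ maxy n21.
have /is_maxP[xS1 _] := maxx; have /is_maxP[yS2 _] := maxy.
have [yx|/ltW xy] := leP y x; first by rewrite S2x in yS1.
by rewrite S1y in xS2.
Qed.

Lemma normal_pair_irr S : ~~ normal_pair S S.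
Proof. by apply/negP => nS; move: (normal_pair_asym nS); rewrite nS. Qed.

(* In a 3-cycle, the smallest of the three maxima would belong to the set
   preceding its own, hence to the set following its own. *)
Lemma normal_pair_acyclic S1 S2 S3 :
  normal_pair S1 S2 -> normal_pair S2 S3 -> ~~ normal_pair S3 S1.
Proof.
move=> n12 n23; apply/negP => n31.
have [x1 max1] := normal_pair_max n12; have [x2 max2] := normal_pair_max n23.
have [x3 max3] := normal_pair_max n31.
have [_ _ N1 le1 _] := normal_pairP _ max1 n12.
have [_ _ N2 le2 _] := normal_pairP _ max2 n23.
have [_ _ N3 le3 _] := normal_pairP _ max3 n31.
have /is_maxP[m1 _] := max1; have /is_maxP[m2 _] := max2.
have /is_maxP[m3 _] := max3.
have [x12|/ltW x21] := leP x1 x2.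
  have [x13|/ltW x31] := leP x1 x3; first by rewrite le2 ?le3 in N1.
  by rewrite le1 ?le2 // in N3; apply: le_trans x12.
have [x23|/ltW x32] := leP x2 x3; first by rewrite le3 ?le1 in N2.
by rewrite le1 ?le2 // in N3; apply: le_trans x21.
Qed.

(* A normal family is an acyclic tournament, hence linearly ordered. *)
Lemma normal_order (L : seq {set E}) : uniq L ->
    {in L &, forall S1 S2, S1 != S2 -> normal_pair S1 S2 || normal_pair S2 S1} ->
  exists2 L', perm_eq L' L & pairwise normal_pair L'.
Proof.
move=> uL tourn; pose le S1 S2 := (S1 == S2) || normal_pair S1 S2.
have le_tot : {in L &, total le}.
  move=> S1 S2 L1 L2; rewrite /le [S2 == S1]eq_sym.
  by case: eqVneq => // ne; apply: tourn.
have le_tr : {in L & &, transitive le}.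
  move=> S2 S1 S3 L2 L1 L3 /predU1P[->//|n12] /predU1P[<-|n23].
    by rewrite /le n12 orbT.
  have [e|ne] := eqVneq S1 S3; first by rewrite -e (negbTE (normal_pair_asym n12)) in n23.
  have := tourn _ _ L1 L3 ne.
  by rewrite (negbTE (normal_pair_acyclic n12 n23)) /le orbF => ->; rewrite orbT.
have pL : perm_eq (sort le L) L by rewrite perm_sort.
exists (sort le L) => //.
have /= := sort_sorted_in le_tot (allss L).
rewrite (sorted_pairwise_in le_tr); last first.
  by apply/allP => S; rewrite mem_sort.
(* Without repetitions the equality alternative in [le] never occurs, which leaves [normal_pair]. *)
have : uniq (sort le L) by rewrite sort_uniq.
elim: (sort le L) => //= S L' IHL /andP[SL' uL'] /andP[/allP aS pw].
rewrite IHL // andbT; apply/allP => S' S'L'.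
by case/predU1P: (aS _ S'L') => // e; rewrite e S'L' in SL'.
Qed.

(** Asymmetry makes the antisymmetry required for uniqueness of sorted lists hold vacuously. *)
Lemma normal_order_unique (L1 L2 : seq {set E}) :
  pairwise normal_pair L1 -> pairwise normal_pair L2 -> perm_eq L1 L2 -> L1 = L2.
Proof.
apply: pairwise_eq => S1 S2 /andP[n12].
by rewrite (negbTE (normal_pair_asym n12)).
Qed.

End NormalPairs.

(** * Words, their descent sets, and recovery letter by letter *)

Section Words.

Context {d : Order.disp_t} {E : finOrderType d}.
Implicit Types (A S : {set E}) (L : seq {set E}) (x y : E) (s t : seq E).

(** The default [x] of [head] makes the last letter a non-descent. *)
Fixpoint descent_sets s : seq {set E} :=
  if s is x :: t then
    if head x t < x then [set z in s | z <= x] :: descent_sets t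
    else descent_sets t
  else [::].

(* The first letter of a word on the alphabet [A] with descent sets [L]: if it is
   not a descent, the word starts with an ascending run through the letters that
   lie below the maximum of the first set but outside it. *)
Definition word_head A L x : bool :=
  if L is S1 :: _ then
    if initial_segment S1 A then is_max S1 x else is_min (A :\: S1) x
  else is_min A x.

Lemma word_head_unique A L x y : word_head A L x -> word_head A L y -> x = y.
Proof.
by case: L => [|S L] /=; [|case: ifP => _]; first [exact: min_unique|exact: max_unique].
Qed.

Lemma not_initial S A x : is_max S x -> S \subset A -> ~~ initial_segment S A ->
  exists y, [/\ y \in A, y \notin S & y < x].
Proof.
move=> maxx SA; have /is_maxP[xS lex] := maxx.
move=> /(initial_segmentP _ maxx)/eqP; rewrite eqEsubset negb_and.
have -> /= : S \subset A :&: [set y | y <= x].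
  by apply/subsetP => y yS; rewrite !inE (subsetP SA) // lex.
case/subsetPn => y; rewrite !inE => /andP[yA yx] yS.
exists y; split=> //; rewrite lt_neqAle yx andbT.
by apply: contraNneq yS => ->.
Qed.

Lemma word_head_exists A L : A != set0 ->
    {in L, forall S, S \subset A /\ (2 <= #|S|)%N} ->
  exists x, word_head A L x.
Proof.
move=> A0; case: L => [|S L] /= LA; first exact: min_exists.
have [SA cS] := LA _ (mem_head _ _).
have /max_exists[x maxx] : S != set0 by rewrite -card_gt0 ltnW.
case: (boolP (initial_segment S A)) => [_|/(not_initial maxx SA)[y [yA yS _]]].
  by exists x.
by apply: min_exists; apply/set0Pn; exists y; rewrite inE yS yA.
Qed.

Lemma mem_descent_sets s S : S \in descent_sets s ->
  S \subset [set z in s] /\ (2 <= #|S|)%N.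
Proof.
elim: s => //= x t IHt.
have IH : S \in descent_sets t -> S \subset [set z in x :: t] /\ (2 <= #|S|)%N.
  case/IHt => St ->; split=> //; apply: (subset_trans St).
  by apply/subsetP => z; rewrite !inE orbC => ->.
case: ifP => // lt_x; rewrite inE => /predU1P[->|//]; split.
  by apply/subsetP => z; rewrite inE [_ \in finset _]inE => /andP[].
apply/card_gt1P; exists (head x t), x; rewrite !inE eqxx lexx (ltW lt_x) lt_eqF //.
by case: t lt_x {IHt IH} => [|y t] /=; rewrite ?ltxx ?mem_head.
Qed.

(** At a descent the first set is cut out of the alphabet by [z <= x], hence is initial with maximum
    [x]. At an ascent the list is that of the tail, whose head [y] is known by induction; [x < y]
    then makes [x] the least letter outside the first set. *)
Lemma descent_sets_head x t : uniq (x :: t) ->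
  word_head [set z in x :: t] (descent_sets (x :: t)) x.
Proof.
elim: t x => [|y t IHt] x.
  move=> _ /=; rewrite ltxx; apply/is_minP; rewrite inE mem_head.
  by split=> // z; rewrite !inE => /eqP->.
move=> /andP[xNt uyt]; have {IHt} := IHt y uyt.
rewrite [descent_sets (x :: _)]/= -/(descent_sets (y :: t)).
set A := [set z in x :: y :: t]; set B := [set z in y :: t].
have AB : A = x |: B by apply/setP => z; rewrite !inE.
have xA : x \in A by rewrite AB setU11.
have xB : x \notin B by rewrite inE.
case: (ltP y x) => [yx _ /=|].
  set S := finset _.
  have maxS : is_max S x.
    by apply/is_maxP; rewrite !inE eqxx lexx; split=> // z; rewrite inE => /andP[].
  suff -> : initial_segment S A by [].
  by apply/(initial_segmentP _ maxS)/setP => z; rewrite !inE.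
rewrite le_eqVlt => /predU1P[e|xy]; first by rewrite e mem_head in xNt.
have min_x (C : {set E}) : C \subset B -> {in C, forall z, y <= z} -> is_min (x |: C) x.
  move=> CB leC; apply/is_minP; rewrite setU11; split=> // z /setU1P[->//|/leC yz].
  by apply: le_trans yz; exact: ltW.
case DL: (descent_sets (y :: t)) => [|S L] /=.
  by rewrite AB => /is_minP[_ lez]; apply: min_x.
have [SB cS] : S \subset B /\ (2 <= #|S|)%N by apply: mem_descent_sets; rewrite DL mem_head.
have /max_exists[m maxm] : S != set0 by rewrite -card_gt0 ltnW.
have /is_maxP[mS lem] := maxm.
have xS : x \notin S by apply: contra xB; exact: (subsetP SB).
have -> : A :\: S = x |: (B :\: S).
  by rewrite AB; apply/setP => z; rewrite !inE; case: eqVneq => //= ->; rewrite xS.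
(* If [S] is initial in [B], then [y] is its maximum and the letters of [B] outside [S] exceed [y];
   adding the missing smaller letter [x] destroys initiality. *)
case: ifPn => [inSB maxy|NinSB /is_minP[_ miny]].
  have e := max_unique maxm maxy; subst m.
  have -> : initial_segment S A = false.
    apply: contraNF xS => /(initial_segmentP _ maxm) ->.
    by rewrite inE xA inE ltW.
  apply: min_x; first exact: subsetDl.
  move=> z /setDP[zB zS]; rewrite leNgt; apply: contra zS => zy.
  by rewrite (initial_segmentP _ maxm inSB) !inE in zB *; rewrite zB ltW.
have -> : initial_segment S A = false.
  apply: contraNF NinSB => /(initial_segmentP _ maxm) defS.
  apply/(initial_segmentP _ maxm)/setP => z.
  rewrite {1}defS AB !in_setI in_setU1; case: eqVneq => //= ->.
  by move/setP/(_ x): defS; rewrite (negbTE xS) (negbTE xB) in_setI xA.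
by apply: min_x => //; exact: subsetDl.
Qed.

(** Alphabet and list determine the first letter. They also tell whether it is a descent, since no
    descent set of the tail contains it. *)
Lemma descent_sets_inj s t : uniq s -> uniq t -> s =i t ->
  descent_sets s = descent_sets t -> s = t.
Proof.
elim: s t => [|x s IHs] [|y t] // us ut.
- by move/(_ y); rewrite mem_head.
- by move/(_ x); rewrite mem_head.
move=> est eL.
have exy : x = y.
  have := descent_sets_head us; rewrite eL.
  have -> : [set z in x :: s] = [set z in y :: t] by apply/setP => z; have := est z; rewrite !inE.
  by move/word_head_unique; apply; apply: descent_sets_head.
subst y; congr (_ :: _).
move: us ut => /andP[xs us] /andP[xt ut].
have st : s =i t.
  move=> z; have := est z; rewrite !inE.
  by case: eqVneq => //= ->; rewrite (negbTE xs) (negbTE xt).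
apply: IHs => //; move: eL => /=; case: ifP => hs; case: ifP => ht //.
- by case.
- have xS : x \in [set z in x :: s | z <= x] by rewrite !inE eqxx lexx.
  move=> e; have : [set z in x :: s | z <= x] \in descent_sets t by rewrite -e mem_head.
  case/mem_descent_sets => /subsetP/(_ _ xS).
  by rewrite inE (negbTE xt).
have xS : x \in [set z in x :: t | z <= x] by rewrite !inE eqxx lexx.
move=> e; have : [set z in x :: t | z <= x] \in descent_sets s by rewrite e mem_head.
by case/mem_descent_sets => /subsetP/(_ _ xS); rewrite inE (negbTE xs).
Qed.

Lemma descent_sets_first y t S : uniq (y :: t) -> S \in descent_sets (y :: t) ->
  y \notin S \/ S = [set z in y :: t | z <= y].
Proof.
move=> /andP[yt _].
have IH : S \in descent_sets t -> y \notin S.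
  by case/mem_descent_sets => /subsetP St _; apply: contra yt => /St; rewrite inE.
rewrite /=; case: ifP => _; last by move/IH; left.
by rewrite inE => /predU1P[->|/IH]; [right|left].
Qed.

(** Sets after the first contain only later letters, so they miss [x], and their elements up to [x]
    lie in the first set. For (iii), the next letter [y] is a witness unless it belongs to the later
    set; that set is then the one of [y] itself and lies inside [T :\ x]. *)
Lemma descent_sets_normal s : uniq s -> pairwise normal_pair (descent_sets s).
Proof.
elim: s => //= x [|y t] IHs /andP[xs us]; first by rewrite ltxx.
rewrite [head _ _]/=; case: ifP => yx; last exact: IHs.
rewrite pairwise_cons IHs // andbT; apply/allP => S S_s.
have [/subsetP SB cS] := mem_descent_sets S_s.
set T := finset _.
have maxT : is_max T x.
  by apply/is_maxP; rewrite !inE eqxx lexx; split=> // z; rewrite inE => /andP[].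
have yTx : y \in T :\ x by rewrite !inE eqxx lt_eqF // ltW ?orbT.
have xS : x \notin S by apply: contra xs => /SB; rewrite inE.
apply/(normal_pairP _ maxT); split=> //.
- by apply/card_gt1P; exists x, y; split; [case/is_maxP: maxT|case/setD1P: yTx|rewrite gt_eqF].
- by move=> z /SB; rewrite inE => zs zx; rewrite inE zx inE zs orbT.
have [yS|eS] := descent_sets_first us S_s; first by right; exists y.
have ST : S \subset T :\ x.
  apply/subsetP => z; rewrite eS !inE => /andP[zs zy].
  rewrite zs orbT (le_trans zy (ltW yx)) !andbT.
  by apply: contraTneq zy => ->; rewrite -ltNge.
case: (boolP (T :\ x \subset S)) => [TS|/subsetPn[z]].
  by left; apply/eqP; rewrite eqEsubset ST.
by right; exists z.
Qed.

(** Induction on the alphabet: the letter given by [word_head] is put in front of a word for the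
    remaining data. What must be checked is that it is a descent exactly when a set was removed;
    [descent_sets_head] supplies the next letter for this. *)
Lemma descent_sets_surj A L :
    {in L, forall S, S \subset A /\ (2 <= #|S|)%N} -> pairwise normal_pair L ->
  exists s, [/\ uniq s, [set z in s] = A & descent_sets s = L].
Proof.
have [k] := ubnP #|A|; elim: k A L => // k IHk A L leAk LA nL.
have [A0|A0] := eqVneq A set0.
  exists [::]; split=> //.
  case: L LA {nL} => // S L /(_ _ (mem_head _ _))[].
  by rewrite A0 subset0 => /eqP->; rewrite cards0.
have [x hx] := word_head_exists A0 LA.
have step L' : x \in A -> {in L', forall S, S \subset A :\ x /\ (2 <= #|S|)%N} ->
    pairwise normal_pair L' ->
    exists t, [/\ uniq (x :: t), [set z in x :: t] = A, descent_sets t = L'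
      & t != [::] -> word_head (A :\ x) L' (head x t)].
  move=> xA L'A nL'; have ltk : (#|A :\ x| < k)%N.
    by move: leAk; rewrite (cardsD1 x A) xA.
  have [t [ut tA tL']] := IHk _ _ ltk L'A nL'.
  have xt : x \notin t by have := setD11 x A; rewrite -tA inE => ->.
  exists t; rewrite /= xt ut; split=> //.
    apply/setP => z; rewrite !inE; move/setP/(_ z): tA; rewrite !inE => ->.
    by case: eqVneq => //= ->; rewrite xA.
  by move: ut tA tL' {xt}; case: t => // y t ut <- <- _; apply: descent_sets_head.
have sets_nil t S L' : descent_sets t = S :: L' -> t != [::] by case: t.
case: L LA nL hx => [|S1 L] LA nL hx.
  have /is_minP[xA lex] := hx.
  have [t [ut tA tL ht]] := step [::] xA (fun _ h => False_ind _ (notF h)) isT.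
  exists (x :: t); split=> //=; rewrite tL ltNge lex //.
  rewrite -tA inE; case: t {ht tA tL ut} => [|y t] /=; first exact: mem_head.
  by rewrite !inE eqxx orbT.
have [S1A c1] := LA _ (mem_head _ _).
have /max_exists[m maxm] : S1 != set0 by rewrite -card_gt0 ltnW.
have /is_maxP[mS1 lem] := maxm.
have LA' : {in L, forall S, S \subset A /\ (2 <= #|S|)%N}.
  by move=> S SL; apply: LA; rewrite inE SL orbT.
move: nL; rewrite pairwise_cons => /andP[/allP nS1 nL].
move: hx; rewrite /=; case: ifPn => [inS1 maxx|NinS1 /is_minP[/setDP[xA xS1] lex]].
  have e := max_unique maxm maxx; subst m.
  have xA := subsetP S1A _ mS1.
  (* Normality keeps the maximum [x] of [S1] out of all later sets. *)
  have LAx : {in L, forall S, S \subset A :\ x /\ (2 <= #|S|)%N}.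
    move=> S SL; have [SA cS] := LA' _ SL; split=> //.
    by rewrite subsetD1 SA; case/(normal_pairP _ maxm): (nS1 _ SL).
  have [t [ut tA tL ht]] := step _ xA LAx nL.
  exists (x :: t); split=> //=; rewrite tL.
  have -> : [set z in x :: t | z <= x] = S1.
    rewrite (initial_segmentP _ maxm inS1) -tA.
    by apply/setP => z; rewrite !inE.
  have [y yS1] : exists y, y \in S1 :\ x.
    by apply/set0Pn; rewrite -card_gt0; move: c1; rewrite (cardsD1 x) mS1.
  have /setD1P[yx {}yS1] := yS1.
  have lt_S1 z : z \in S1 -> z != x -> z < x by move=> zS1 zx; rewrite lt_neqAle zx lem.
  have yA : y \in A :\ x by rewrite !inE yx (subsetP S1A).
  have t0 : t != [::].
    apply: contraNneq yx => t0; move: yA; rewrite -tA t0 !inE.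
    by case: eqVneq.
  suff -> : head x t < x by [].
  have {ht} := ht t0; case: L LAx nS1 {LA LA' nL step tL} => [|S2 L] LAx nS1 /=.
    by case/is_minP => _ /(_ _ yA) le_y; apply: le_lt_trans le_y (lt_S1 _ yS1 yx).
  have [_ c2 xS2 S2x dS2] := normal_pairP _ maxm (nS1 _ (mem_head _ _)).
  have [S2A _] := LAx _ (mem_head _ _).
  have /max_exists[x2 max2] : S2 != set0 by rewrite -card_gt0 ltnW.
  have /is_maxP[x2S2 le2] := max2.
  (* Condition (iii) is what forces a descent at [x]: it provides a letter of
     [A :\ x] below [x] that bounds the head of [t]. *)
  case: ifPn => [inS2|NinS2].
    move/(max_unique max2) => <-.
    have x2x : x2 != x by apply: contraNneq xS2 => <-.
    case: dS2 => [eS2|[w /setD1P[wx wS1] wS2]].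
      by apply: lt_S1 => //; move: x2S2; rewrite {1}eS2 => /setD1P[].
    (* Were [x <= x2], the initial segment [S2] would contain [w], which lies below [x]. *)
    rewrite ltNge; apply: contra wS2 => xx2.
    rewrite (initial_segmentP _ max2 inS2) !inE wx (subsetP S1A) //=.
    by apply: le_trans xx2; exact: lem.
  case/is_minP => _ min2.
  have [w [wA wS2 wx]] : exists w, [/\ w \in A :\ x, w \notin S2 & w < x].
    case: dS2 => [eS2|[w /setD1P[wx wS1] wS2]].
      have [w [wA wS2 wx2]] := not_initial max2 S2A NinS2.
      exists w; split=> //; apply: lt_le_trans wx2 _; apply: lem.
      by move: x2S2; rewrite {1}eS2 => /setD1P[].
    by exists w; rewrite !inE wx (subsetP S1A) // wS2 lt_S1.
  by apply: le_lt_trans (min2 _ _) wx; rewrite inE wS2 wA.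
have [w [wA wS1 wm]] := not_initial maxm S1A NinS1.
have xm : x < m by apply: le_lt_trans wm; apply: lex; rewrite inE wS1 wA.
(* A later set containing [x], which is below [m], would by normality force [x] into [S1]. *)
have LAx : {in S1 :: L, forall S, S \subset A :\ x /\ (2 <= #|S|)%N}.
  move=> S SL; have [SA cS] := LA _ SL; split=> //; rewrite subsetD1 SA /=.
  move: SL; rewrite inE => /predU1P[->//|SL].
  have [_ _ _ Sm _] := normal_pairP _ maxm (nS1 _ SL).
  by apply: contra xS1 => xS; apply: Sm => //; exact: ltW.
have [|t [ut tA tL ht]] := step _ xA LAx; first by rewrite pairwise_cons nL andbT; apply/allP.
exists (x :: t); split=> //=; rewrite tL.
(* The next letter is [m] if [S1] has become initial, and otherwise another letter outside [S1];
   both exceed [x]. *)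
suff /lt_gtF -> : x < head x t by [].
have {ht} /= := ht (sets_nil _ _ _ tL); case: ifPn => [inS1|_].
  by move/(max_unique maxm) => <-.
case/is_minP => /setDP[/setD1P[hx hA] hS1] _.
by rewrite lt_neqAle eq_sym hx lex // inE hS1.
Qed.

End Words.

(** * Normality and [Psi] in terms of exponents *)

Section Monomials.

Context {d : Order.disp_t} {E : finOrderType d}.
Implicit Types (m q : monomial E) (X Y : big_subset E).

Lemma hE X Y : h X Y = (X == Y).
Proof. exact: ucmE. Qed.

Lemma mmulhE X m Y : mmul (h X) m Y = ((X == Y) + m Y)%N.
Proof. by rewrite -hE; exact: mulcmE. Qed.

Lemma mmulhhE X Y Z : mmul (h X) (h Y) Z = ((X == Z) + (Y == Z))%N.
Proof. by rewrite mmulhE hE. Qed.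

Lemma h_divides m X : m X != 0%N -> exists r, m = mmul (h X) r.
Proof.
move=> mX; exists (divcm m (h X)); apply/eqP/cmP => Y.
rewrite mmulhE divcmE hE subnKC //.
by case: eqVneq => // <-; rewrite lt0n.
Qed.

Lemma monomial_divides_leq q m X : monomial_divides q m -> (q X <= m X)%N.
Proof. by case=> r ->; rewrite [leqRHS]mulcmE leq_addr. Qed.

(** Sums of Booleans treat squares and products of distinct variables together: for [X = Y] both
    bounds ask for exponent two. *)
Lemma mmulhh_divides m X Y :
  ((X == X) + (Y == X) <= m X)%N -> ((X == Y) + (Y == Y) <= m Y)%N ->
  monomial_divides (mmul (h X) (h Y)) m.
Proof.
rewrite !eqxx => leX leY.
have [|r mE] := @h_divides m X; first by apply: contraTneq leX => ->.
have [|r' rE] := @h_divides r Y.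
  apply: contraTneq leY => rY; rewrite mE mmulhE rY.
  by rewrite addn0 -ltnNge addn1.
by exists r'; rewrite mE rE; exact: mulcmA.
Qed.

Lemma mdegh X : mdeg (h X) = 1%N.
Proof. exact: mdegU. Qed.

Lemma mdeg_mmulh X m : mdeg (mmul (h X) m) = (mdeg m).+1.
Proof. by apply: etrans (mdegM _ _) _; rewrite mdegh. Qed.

Lemma mdeg2 q : mdeg q = 2%N -> exists X Y, q = mmul (h X) (h Y).
Proof.
have factor (r : monomial E) : mdeg r != 0%N -> exists X r', r = mmul (h X) r'.
  rewrite mdeg_eq0 => /cmP r1.
  have [X rX|r0] := pickP (fun X => r X != 0%N).
    by exists X; apply: h_divides.
  by case: r1 => X; rewrite [RHS]cm1; apply/eqP/negbFE/r0.
move=> q2; have [|X [r qE]] := factor q; first by rewrite q2.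
move: q2; rewrite qE mdeg_mmulh => -[r1].
have [|Y [r' rE]] := factor r; first by rewrite r1.
move: r1; rewrite rE mdeg_mmulh => -[/mdeg_eq0I ->].
by exists X, Y; congr mmul; exact: mulcm0.
Qed.

(** Comparing exponents shows that a factorization into two variables is unique up to order. *)
Lemma normal_quadratic_hh X Y : normal_quadratic (mmul (h X) (h Y)) <->
  normal_pair (val X) (val Y) \/ normal_pair (val Y) (val X).
Proof.
split=> [[S1 [S2 [/eqP/cmP qE n12]]]|[nXY|nYX]]; last 2 first.
- by exists X, Y.
- by exists Y, X; split; first exact: mulcmC.
have {}qE Z : ((X == Z) + (Y == Z) = (S1 == Z) + (S2 == Z))%N.
  by rewrite -!mmulhhE.
have S12 : S1 != S2.
  by apply: contraTneq n12 => ->; exact: normal_pair_irr.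
have := qE S1; have := qE S2; rewrite !eqxx [S2 == S1]eq_sym (negbTE S12).
have [->|_] := eqVneq X S1.
  by rewrite (negbTE S12); case: eqVneq => // -> _ _; left.
have [->|//] := eqVneq Y S1.
by rewrite (negbTE S12); case: eqVneq => // -> _ _; right.
Qed.

(** Squares are never normal by irreflexivity, so a normal monomial is a set of variables that are
    pairwise comparable. *)
Lemma normal_monomialP m : normal_monomial m <->
  (forall X, (m X <= 1)%N) /\
  (forall X Y, m X != 0%N -> m Y != 0%N -> X != Y ->
     normal_pair (val X) (val Y) || normal_pair (val Y) (val X)).
Proof.
have deg2 X Y : mdeg (mmul (h X) (h Y)) = 2%N by rewrite mdeg_mmulh mdegh.
split=> [nm|[m1 nm] q /mdeg2[X [Y ->]] dvd].
  split=> [X|X Y mX mY XY].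
    rewrite leqNgt; apply/negP => mX.
    suff /(nm _ (deg2 X X))/normal_quadratic_hh :
      monomial_divides (mmul (h X) (h X)) m by case; apply/negP/normal_pair_irr.
    by apply: mmulhh_divides; rewrite !eqxx.
  apply/orP/normal_quadratic_hh/nm; first exact: deg2.
  apply: mmulhh_divides; rewrite !eqxx.
    by rewrite eq_sym (negbTE XY) lt0n.
  by rewrite (negbTE XY) lt0n.
have := monomial_divides_leq X dvd; have := monomial_divides_leq Y dvd.
rewrite !mmulhhE !eqxx => leY leX.
apply/normal_quadratic_hh/orP; apply: nm.
- by apply: contraTneq leX => ->.
- by apply: contraTneq leY => ->; rewrite addn1.
by apply: contraTneq (m1 X) => XY; rewrite -ltnNge (leq_trans _ leX) // XY eqxx.
Qed.

Section Word.

Context {n : nat}.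
Implicit Types (s : {ffun 'I_n -> E}) (i : 'I_n).

Definition word s : seq E := [seq s i | i <- enum 'I_n].

Lemma size_word s : size (word s) = n.
Proof. by rewrite size_map size_enum_ord. Qed.

Lemma drop_word s i : drop i (word s) = s i :: drop i.+1 (word s).
Proof.
have lt_i : (i < size (enum 'I_n))%N by rewrite size_enum_ord.
rewrite /word (drop_nth (s i)); last by rewrite size_map.
by rewrite (nth_map i) // nth_ord_enum.
Qed.

Lemma mem_drop_word s k x :
  reflect (exists2 i : 'I_n, (k <= i)%N & x = s i) (x \in drop k (word s)).
Proof.
have drop_enum i : (i \in drop k (enum 'I_n)) = (k <= i)%N.
  rewrite -(mem_map val_inj) map_drop val_enum_ord drop_iota mem_iota add0n.
  have [ki|//] := leqP k i.
  by rewrite subnKC ?ltn_ord //; exact: ltnW (leq_ltn_trans ki (ltn_ord i)).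
rewrite /word -map_drop; apply: (iffP mapP) => -[i ki ->]; exists i => //.
  by rewrite -drop_enum.
by rewrite drop_enum.
Qed.

Lemma head_drop_word s i :
  (head (s i) (drop i.+1 (word s)) < s i) = (i \in descents s).
Proof.
rewrite inE; apply/idP/existsP => [|[j /andP[/eqP ji sji]]].
  (* At the last position the remaining word is empty and [head] returns [s i], so there is no
     descent. *)
  have [lt_n|le_n] := ltnP i.+1 n; last first.
    by rewrite drop_oversize ?ltxx // size_word.
  have := drop_word s (Ordinal lt_n); rewrite /= => -> sji.
  by exists (Ordinal lt_n); rewrite eqxx.
by have := drop_word s j; rewrite -ji => ->.
Qed.

Lemma descent_set_drop_word s i :
  [set x in drop i (word s) | x <= s i] = descent_set s i.
Proof.
apply/setP => x; rewrite inE; apply/andP/imsetP => [[/mem_drop_word[j ij ->] xi]|[j]].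
  by exists j; rewrite // inE ij.
by rewrite inE => /andP[ij ji] ->; split=> //; apply/mem_drop_word; exists j.
Qed.

Lemma count_descent_sets s S :
  count_mem S (descent_sets (word s)) = \sum_(i in descents s) (descent_set s i == S).
Proof.
(* The count is generalized to suffixes and proved by induction on their length [n - k]. *)
have count_drop k : (k <= n)%N -> count_mem S (descent_sets (drop k (word s))) =
    \sum_(i : 'I_n | (k <= i)%N) ((i \in descents s) && (descent_set s i == S)).
  move=> kn; rewrite -(subKn kn); elim: (n - k)%N (leq_subr k n) => [|l IHl] ln.
    rewrite subn0 drop_oversize ?size_word // big1 // => i.
    by rewrite leqNgt ltn_ord.
  have lt_n : (n - l.+1 < n)%N by rewrite ltn_subrL (leq_trans _ ln).
  pose i := Ordinal lt_n.
  have iE : (n - l = i.+1)%N by rewrite /= subnSK.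
  rewrite (bigD1 i) //= (drop_word s i).
  rewrite [descent_sets _]/= head_drop_word -(drop_word s i) descent_set_drop_word.
  have {}IHl := IHl (ltnW ln).
  rewrite iE in IHl.
  transitivity (((i \in descents s) && (descent_set s i == S)) +
      count_mem S (descent_sets (drop i.+1 (word s))))%N.
    by case: ifP => _ //=.
  congr addn; rewrite IHl; apply: eq_bigl => j.
  by rewrite andbC ltn_neqAle eq_sym.
rewrite -[word s in LHS]drop0 count_drop // [RHS]big_mkcond /=.
by apply: eq_bigr => i _; case: ifP.
Qed.

Lemma PsiE s X : Psi s X = count_mem (val X) (descent_sets (word s)).
Proof.
rewrite count_descent_sets /Psi (big_sub _ (fun i => (descent_set s i == val X) : nat)).
elim/big_rec2: _ => [|i c m _ <-]; first exact: onecmE.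
by rewrite mmulhE.
Qed.

End Word.

End Monomials.

(** * Bijectivity of [Psi] *)

Section PsiBijective.

Context {d : Order.disp_t} {E : finOrderType d} {n : nat}.
Implicit Types (s t : {ffun 'I_n -> E}).

Lemma word_uniq s : bijective s -> uniq (word s).
Proof. by move=> /bij_inj s_inj; rewrite map_inj_uniq // enum_uniq. Qed.

Lemma mem_word s x : bijective s -> x \in word s.
Proof. by case=> g _ gK; rewrite -[x]gK map_f // mem_enum. Qed.

Lemma Psi_normal s : bijective s -> normal_monomial (Psi s).
Proof.
move=> /word_uniq us; have nL := descent_sets_normal us.
have uL : uniq (descent_sets (word s)).
  rewrite uniq_pairwise; apply: sub_pairwise nL => S1 S2 n12 /=.
  by apply: contraTneq n12 => ->; exact: normal_pair_irr.
apply/normal_monomialP; split=> [X|X Y]; rewrite !PsiE.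
  by rewrite count_uniq_mem // leq_b1.
rewrite -!lt0n -!has_count !has_pred1 -val_eqE /=.
elim: (descent_sets (word s)) nL {uL} => //= S L IHL /andP[/allP nS nL].
rewrite !inE => /predU1P[eX|XL] /predU1P[eY|YL] XY.
- by rewrite eX eY eqxx in XY.
- by rewrite eX nS.
- by rewrite eY nS ?orbT.
exact: IHL.
Qed.

Lemma Psi_inj s t : bijective s -> bijective t -> Psi s = Psi t -> s = t.
Proof.
move=> bs bt ePsi; have [us ut] := (word_uniq bs, word_uniq bt).
have eL : descent_sets (word s) = descent_sets (word t).
  apply: normal_order_unique; try exact: descent_sets_normal.
  (* Exponents give the multiplicities of sets with at least two elements; smaller sets occur in
     neither list. *)
  apply/allP => S _ /=.
  have [cS|cS] := boolP (2 <= #|S|)%N; first by rewrite -!(PsiE _ (Sub S cS)) ePsi.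
  by rewrite !(count_memPn _) //; apply: contra cS => /mem_descent_sets[].
have /eq_in_map es : word s = word t.
  by apply: descent_sets_inj => // x; rewrite !mem_word.
by apply/ffunP => i; apply: es; rewrite mem_enum.
Qed.

(** The sets with nonzero exponent, put in their normal order, are the descent sets of a word using
    each letter of [E] once, so of length [n]. *)
Lemma Psi_surj (cardE : #|E| = n) (m : monomial E) : normal_monomial m ->
  exists2 s : {ffun 'I_n -> E}, bijective s & Psi s = m.
Proof.
move=> /normal_monomialP[m1 nm].
pose L0 : seq {set E} := [seq val X | X <- enum {: big_subset E} & m X != 0%N].
have uL0 : uniq L0.
  by rewrite (map_inj_uniq val_inj) filter_uniq // enum_uniq.
have mL0 X : (val X \in L0) = (m X != 0%N).
  by rewrite (mem_map val_inj) mem_filter mem_enum andbT.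
have [|L pL nL] := normal_order uL0.
  move=> _ _ /mapP[X + ->] /mapP[Y + ->]; rewrite !mem_filter => /andP[mX _] /andP[mY _].
  by rewrite val_eqE; exact: nm.
have [|w [uw wE wL]] := @descent_sets_surj _ _ [set: E] L _ nL.
  by move=> S; rewrite (perm_mem pL) => /mapP[X _ ->]; split; [exact: subsetT|exact: (valP X)].
have size_w : size w == n by rewrite -(card_uniqP uw) -cardE -cardsT -wE cardsE.
pose s := [ffun i => tnth (Tuple size_w) i].
have ws : word s = w.
  rewrite /word (eq_map (ffunE _)); exact: map_tnth_enum (Tuple size_w).
exists s.
  apply: inj_card_bij; last by rewrite card_ord cardE.
  by move=> i j; rewrite !ffunE; apply/tuple_uniqP.
apply/eqP/cmP => X; rewrite PsiE ws wL (permP pL) count_uniq_mem // mL0.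
(* Exponents are at most one, so they equal the Boolean [m X != 0]. *)
by case: (m X) (m1 X) => [|[]].
Qed.

End PsiBijective.

Theorem proposition2p11 (d : Order.disp_t) (E : finOrderType d) (n : nat)
    (cardE : #|E| = n) :
  set_bij (bijections E n) (NM E) (@Psi d E n).
Proof.
split=> [s|s t /set_mem bs /set_mem bt|m /(Psi_surj cardE)[s bs <-]].
- exact: Psi_normal.
- exact: Psi_inj.
by exists s.
Qed.
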